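(* Let $W\in\mathbb{R}^{n\times n}$ be such that 1) $WW^H = W^HW$ (i.e. $W$ is a normal matrix), and 2) every eigenvalue $\lambda_i\in\mathbb{C}$ of $W$ satisfies $|1-\lambda_i|<1$ or $\lambda_i=0$. Let $s_0\in\mathbb{R}^n$ and define the sequence $\{s_m\}_{m\ge 0}$ by $s_{m+1}=s_m-Ws_m$ for all $m\ge 0$. Then $\{s_m\}$ converges as $m\to\infty$ to $$s_\infty = Q D Q^H s_0,$$ where $Q\in\mathbb{C}^{n\times n}$ is a unitary matrix such that $W=QTQ^H$ with $T$ a diagonal matrix (with diagonal entries $\lambda_i=T_{i,i}$, the eigenvalues of $W$), and $D$ is the diagonal matrix defined by $$D_{i,i}=\begin{cases}1 & \text{if } \lambda_i=T_{i,i}=0,\\ 0 & \text{if } |1-\lambda_i|<1.\end{cases}$$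
   Context: The recursion $s_{m+1}=s_m-Ws_m$ is the inner loop (''sifting process'') of the general discrete Iterative Filtering algorithm: a signal on a finite index set of size $n$ is identified with a vector in $\mathbb{R}^n$, the initial vector $s_0$ is the current signal, and $W\in\mathbb{R}^{n\times n}$ is a fixed matrix during the loop. Convergence of the inner loop means convergence of the sequence $\{s_m\}$ when the iteration is continued indefinitely (no stopping criterion). $M^H$ denotes the conjugate transpose of $M$. *)

(* Defs.v *)
From HB Require Import structures.
From mathcomp Require Export all_boot all_order all_algebra.
From mathcomp Require Export complex.
From mathcomp Require Export all_classical all_reals all_analysis.

Set Implicit Arguments.
Unset Strict Implicit.
Unset Printing Implicit Defensive.

Import Order.TTheory GRing.Theory Num.Theory.
Import numFieldNormedType.Exports.
Local Open Scope ring_scope.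
Local Open Scope complex_scope.
Local Open Scope sesquilinear_scope.

Definition complexify (R : realType) (m n : nat) (A : 'M[R]_(m, n)) :
  'M[R[i]]_(m, n) := map_mx (real_complex R) A.

Definition unitary_diagonalization (R : realType) (n : nat)
    (A Q T : 'M[R[i]]_n) : Prop :=
  [/\ Q \is unitarymx, is_diag_mx T & A = Q *m T *m Q ^t*].

(* Stated by the two defining cases rather than with an [if]: they are
   mutually exclusive, and exhaustive as soon as every T i i is either 0 or
   at distance < 1 from 1. *)
Definition null_indicator (R : realType) (n : nat) (T D : 'M[R[i]]_n) : Prop :=
  is_diag_mx D /\
  forall i : 'I_n,
    (T i i = 0 -> D i i = 1) /\ (`|1 - T i i| < 1 -> D i i = 0).

(* Main.v *)
Require Import Defs.

Set Implicit Arguments.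
Unset Strict Implicit.
Unset Printing Implicit Defensive.

Import Order.TTheory GRing.Theory Num.Theory.
Import numFieldNormedType.Exports.
Local Open Scope classical_set_scope.
Local Open Scope ring_scope.
Local Open Scope complex_scope.
Local Open Scope sesquilinear_scope.

(** In the coordinates [y m = Q^H s_m] the recursion decouples into
    [y (m+1) k = (1 - lambda_k) y m k], so each coordinate is a geometric
    sequence of ratio [1 - lambda_k].  It tends to [0] when
    [|1 - lambda_k| < 1] and is constant when [lambda_k = 0], i.e. it tends to
    [(D y 0) k] in both cases.  The [s_m] being real, so is their limit, and
    uniqueness of limits shows that it does not depend on [Q]. *)

(** A neighbourhood of [M] contains a product of neighbourhoods [P i j] of its entries, and a filter
    is stable under finite intersections. *)
Lemma cvg_mx_coord (K : numFieldType) (I : Type) (F : set_system I)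
    (m n : nat) (f : I -> 'M[K]_(m, n)) (M : 'M[K]_(m, n)) : Filter F ->
  (forall i j, f x i j @[x --> F] --> M i j) -> f @ F --> M.
Proof.
move=> FF fM A [P nbhsP PA].
apply: (@filterS _ F _ [set x | forall i j, P i j (f x i j)]) => [x /PA//|].
by apply: filter_forall => i; apply: filter_forall => j; exact: fM.
Qed.

Section ComplexNorm.
Variable R : realType.
Implicit Types x y : R[i].

(** A modulus in [R[i]] is itself a complex number; this moves it to [R], where all the limits are
    taken. *)
Lemma normcRe x : `|x| = (complex.Re `|x|)%:C.
Proof. by rewrite RRe_real// normr_real. Qed.

Lemma norm_Re_le x : `|complex.Re x| <= complex.Re `|x|.
Proof. by rewrite -lecR -normcRe normc_ge_Re. Qed.

Lemma norm_Im_le x : `|complex.Im x| <= complex.Re `|x|.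
Proof.
by rewrite -lecR -normcRe normc_def lecR -sqrtr_sqr ler_wsqrtr// lerDr sqr_ge0.
Qed.

Lemma cvg_Re_Im (u : nat -> R[i]) (l : R[i]) :
  complex.Re `|u m - l| @[m --> \oo] --> 0 ->
  complex.Re (u m) @[m --> \oo] --> complex.Re l /\
  complex.Im (u m) @[m --> \oo] --> complex.Im l.
Proof.
move=> ul.
(* Real and imaginary parts are handled together, as subtractive maps dominated by the modulus. *)
have dominated (f : R[i] -> R) : {morph f : x y / x - y} ->
    (forall x, `|f x| <= complex.Re `|x|) -> f (u m) @[m --> \oo] --> f l.
  move=> fB f_le; apply/subr_cvg0; apply: norm_cvg0.
  apply: (squeeze_cvgr _ (cvg_cst 0) ul).
  by apply: nearW => m; rewrite normr_ge0/= -fB.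
by split; apply: dominated; [exact: raddfB | exact: norm_Re_le
  | exact: raddfB | exact: norm_Im_le].
Qed.

(** The triangle inequality bounds the modulus by a finite sum of real sequences, each of them
    geometric with ratio below 1 or identically zero. *)
Lemma cvg_sum_geometric0 (I : finType) (c z : I -> R[i]) :
  (forall k, `|z k| < 1 \/ c k = 0) ->
  complex.Re `|\sum_k c k * z k ^+ m| @[m --> \oo] --> 0.
Proof.
move=> cz.
have sum0 : \sum_k complex.Re `|c k| * complex.Re `|z k| ^+ m @[m --> \oo]
    --> (0 : R).
  rewrite [X in _ --> X](_ : 0 = \sum_(k : I) (0 : R)); last by rewrite big1_eq.
  apply: cvg_big => [|k _]; first exact: add_continuous.
  have [zk1|->] := cz k; last first.
    by rewrite normr0; under eq_fun do rewrite mul0r; exact: cvg_cst.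
  apply: cvg_geometric; rewrite ger0_norm; last by rewrite -lecR -normcRe normr_ge0.
  by rewrite -ltcR -normcRe.
apply: (squeeze_cvgr _ (cvg_cst 0) sum0); apply: nearW => m.
rewrite -!lecR -normcRe normr_ge0/= rmorph_sum/=.
apply: (le_trans (ler_norm_sum _ _ _)); apply: ler_sum => k _.
by rewrite normrM normrX rmorphM rmorphXn/= -!normcRe.
Qed.

End ComplexNorm.

Section Diagonalization.
Variables (R : realType) (n : nat) (A Q T : 'M[R[i]]_n).
Hypothesis AQT : unitary_diagonalization A Q T.

Lemma unitary_diagonalization_mulV : Q *m Q ^t* = 1%:M.
Proof. by case: AQT => /unitarymxP. Qed.

Lemma unitary_diagonalization_Vmul : Q ^t* *m Q = 1%:M.
Proof. exact/mulmx1C/unitary_diagonalization_mulV. Qed.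

Lemma unitary_diagonalization_adj : Q ^t* *m A = T *m Q ^t*.
Proof.
case: AQT => _ _ ->.
by rewrite !mulmxA unitary_diagonalization_Vmul mul1mx.
Qed.

Lemma diag_mul_coord (S : 'M[R[i]]_n) (y : 'cV[R[i]]_n) k :
  is_diag_mx S -> (S *m y) k 0 = S k k * y k 0.
Proof.
by move=> /diag_mxP[d ->]; rewrite mul_diag_mx !mxE eqxx mulr1n.
Qed.

(** Eigenvectors are row vectors here, and [Q ^t* *m A = T *m Q ^t*] makes row [k] of [Q ^t*] one
    for [T k k]. This lets the spectral hypothesis on [W] apply to the diagonal of [T]. *)
Lemma unitary_diagonalization_eigenvalue k : eigenvalue A (T k k).
Proof.
have [_ /diag_mxP[d Td] _] := AQT.
apply/eigenvalueP; exists (row k (Q ^t*)).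
  rewrite -row_mul unitary_diagonalization_adj Td mul_diag_mx.
  by apply/rowP => j; rewrite !mxE eqxx mulr1n.
(* If this row vanished, so would row [k] of [Q ^t* *m Q = 1%:M]. *)
apply/eqP => Qk0; have := unitary_diagonalization_Vmul.
move=> /(congr1 (row k)); rewrite row_mul Qk0 mul0mx => /rowP/(_ k).
by rewrite !mxE eqxx => /esym/eqP; rewrite oner_eq0.
Qed.

End Diagonalization.

Section Iteration.
Variables (R : realType) (n : nat) (W : 'M[R]_n).
Hypothesis W_eigen : forall lambda : R[i], eigenvalue (complexify W) lambda ->
  `|1 - lambda| < 1 \/ lambda = 0.
Variable s : nat -> 'cV[R]_n.
Hypothesis s_step : forall m : nat, s m.+1 = s m - W *m s m.
Variables Q T D : 'M[R[i]]_n.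
Hypothesis WQT : unitary_diagonalization (complexify W) Q T.
Hypothesis TD : null_indicator T D.

Let L := Q *m D *m Q ^t* *m complexify (s 0%N).
Let y m := Q ^t* *m complexify (s m).

Lemma iteration_eigencoord m k : y m k 0 = (1 - T k k) ^+ m * y 0%N k 0.
Proof.
elim: m => [|m IHm]; first by rewrite expr0 mul1r.
have [_ Tdiag _] := WQT.
rewrite /y s_step /complexify map_mxB map_mxM mulmxBr mulmxA.
rewrite (unitary_diagonalization_adj WQT) -mulmxA mxE [X in _ + X]mxE.
rewrite (diag_mul_coord _ _ Tdiag) exprS -mulrA -IHm.
by rewrite mulrBl mul1r.
Qed.

(** Where [T k k = 0] the coordinate is constant and [D k k = 1] cancels it exactly, hence the
    coefficient 0 against the ratio 1; elsewhere [D k k = 0] and the whole geometric term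
    remains. *)
Lemma iteration_error_coord m i :
  complexify (s m) i 0 - L i 0 =
  \sum_k (if T k k == 0 then 0 else Q i k * y 0%N k 0) * (1 - T k k) ^+ m.
Proof.
have [Ddiag Dkk] := TD.
have -> : complexify (s m) = Q *m y m.
  by rewrite mulmxA (unitary_diagonalization_mulV WQT) mul1mx.
have -> : L = Q *m (D *m y 0%N) by rewrite /L !mulmxA.
rewrite !mxE -sumrB; apply: eq_bigr => k _.
rewrite (iteration_eigencoord m) (diag_mul_coord _ _ Ddiag).
have [T0 T1] := Dkk k; have [Tk0|Tk_neq0] := eqVneq (T k k) 0.
  by rewrite Tk0 T0// subr0 expr1n mul0r subrr.
have [|/eqP] := W_eigen (unitary_diagonalization_eigenvalue WQT k).
  by move=> /T1 ->; rewrite mul0r mulr0 subr0 mulrCA mulrC.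
by rewrite (negPf Tk_neq0).
Qed.

Lemma iteration_error_cvg0 i :
  complex.Re `|complexify (s m) i 0 - L i 0| @[m --> \oo] --> 0.
Proof.
under eq_fun do rewrite iteration_error_coord.
apply: cvg_sum_geometric0 => k; case: eqP => [|Tk_neq0]; first by right.
by have [|//] := W_eigen (unitary_diagonalization_eigenvalue WQT k); left.
Qed.

Lemma iteration_cvg : s @ \oo --> map_mx (@complex.Re R) L.
Proof.
apply: cvg_mx_coord => i j; rewrite ord1 mxE.
have [+ _] := cvg_Re_Im (iteration_error_cvg0 i).
by under eq_fun do rewrite mxE.
Qed.

(** The imaginary parts of the iterates are constantly 0, so by uniqueness of limits those of [L]
    vanish. *)
Lemma iteration_limit_real : complexify (map_mx (@complex.Re R) L) = L.
Proof.
apply/colP => i; have [_] := cvg_Re_Im (iteration_error_cvg0 i).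
under eq_fun do rewrite mxE/=.
move=> /(cvg_unique _ (cvg_cst 0)) ImL0.
by rewrite !mxE; move: ImL0; rewrite mxE; case: (\sum_ _ _) => a b /= <-.
Qed.

End Iteration.

Lemma normal_unitary_diagonalization (R : realType) (n : nat)
    (A : 'M[R[i]]_n) : A \is normalmx ->
  exists Q T, unitary_diagonalization A Q T.
Proof.
move=> /orthomx_spectralP A_spec.
(* The spectral theorem reads [A = invmx P *m diag_mx d *m P] with [P] unitary, so [Q] is the
   adjoint of [P]. *)
exists ((spectralmx A) ^t*), (diag_mx (spectral_diag A)).
split; first by rewrite trmxC_unitary spectral_unitarymx.
  exact: diag_mx_is_diag.
by rewrite trmxCK -(invmx_unitary (spectral_unitarymx A)).
Qed.

Lemma null_indicator_exists (R : realType) (n : nat) (T : 'M[R[i]]_n) :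
  exists D, null_indicator T D.
Proof.
exists (diag_mx (\row_k (T k k == 0)%:R)).
split=> [|k]; first exact: diag_mx_is_diag.
rewrite !mxE eqxx mulr1n; split=> [->|]; first by rewrite eqxx.
(* The two cases are compatible: [T k k = 0] gives a distance to 1 equal to 1, not below it. *)
by have [->|//] := eqVneq; rewrite subr0 normr1 ltxx.
Qed.

Theorem theorem1 (R : realType) (n : nat) (W : 'M[R]_n)
    (W_normal : complexify W \is normalmx)
    (W_eigen : forall lambda : R[i], eigenvalue (complexify W) lambda ->
       `|1 - lambda| < 1 \/ lambda = 0)
    (s0 : 'cV[R]_n) (s : nat -> 'cV[R]_n)
    (s_init : s 0%N = s0)
    (s_step : forall m : nat, s m.+1 = s m - W *m s m) :
  exists s_infty : 'cV[R]_n,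
    [/\ s @ \oo --> s_infty,
        (exists Q T D : 'M[R[i]]_n,
           unitary_diagonalization (complexify W) Q T /\ null_indicator T D) &
        (forall Q T D : 'M[R[i]]_n,
           unitary_diagonalization (complexify W) Q T -> null_indicator T D ->
           complexify s_infty = Q *m D *m Q ^t* *m complexify s0)].
Proof.
have [Q [T WQT]] := normal_unitary_diagonalization W_normal.
have [D TD] := null_indicator_exists T.
have s_cvg := iteration_cvg W_eigen s_step WQT TD.
eexists; split; [exact: s_cvg | by exists Q, T, D |] => Q' T' D' WQT' TD'.
(* For any other triple, the right-hand side is the complexification of a real column that is also a
   limit of [s]; the two limits are then compared entry by entry. *)
rewrite -s_init -(iteration_limit_real W_eigen s_step WQT' TD').
congr complexify; apply/colP => i.
have coord (M : 'cV[R]_n) :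
    s @ \oo --> M -> s m i 0 @[m --> \oo] --> M i 0.
  by move=> sM; exact: continuous_cvg (@coord_continuous R n 1 i 0 M) sM.
have s_cvg' := iteration_cvg W_eigen s_step WQT' TD'.
exact: (cvg_unique _ (coord _ s_cvg) (coord _ s_cvg')).
Qed.
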